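(* Let $(G,H,\theta)$ be a connected symmetric pair over $F$ with $G$ an unramified connected reductive group, and let $\mathcal{Q}=G/H$, viewed as a closed subvariety of $G$ by the symmetrization map. For any strongly compact element $x\in G(F)$, let $x=x_{as}x_{tu}$ be its topological Jordan decomposition. Then $x\in\mathcal{Q}(F)$ if and only if $x_{as}\in\mathcal{Q}(F)$ and $x_{tu}\in\mathcal{Q}(F)$.
   Context: $F$ is a non-archimedean local field of characteristic zero with odd residue characteristic $p$, residue field of cardinality $q$, and algebraic closure $F^{alg}$. A symmetric pair is a triple $(G,H,\theta)$ where $H\subset G$ are reductive groups and $\theta$ is an involution of $G$ with fixed-point subgroup $H$; it is connected if $G/H$ is connected. Put $\sigma(g)=\theta(g)^{-1}$. The symmetrization map $s(g)=g\sigma(g)=g\theta(g)^{-1}$ induces a closed embedding $\mathcal{Q}=G/H\hookrightarrow G$; thus $\mathcal{Q}(F)$ is the set of $x\in G(F)$ with $x=s(g)$ for some $g\in G(F^{alg})$. For a profinite group $K$ with a normal pro-$p$ subgroup $L$ of finite index, let $c_K$ be the prime-to-$p$ part of $|K/L|$ (independent of $L$). Let $c_G$ be the least common multiple of the $c_{K_i}$, where $K_1,\dots,K_d$ represent the conjugacy classes of maximal compact subgroups of $G(F)$. An element $\gamma\in G(F)$ is topologically unipotent if $\lim_{m\to\infty}\gamma^{q^m}=1$; a semi-simple $\gamma\in G(F)$ is absolutely semi-simple if $\gamma^{c_G}=1$; $\gamma$ is strongly compact if it lies in a compact subgroup of $G(F)$. Each strongly compact $\gamma$ has a unique decomposition $\gamma=\gamma_{as}\gamma_{tu}=\gamma_{tu}\gamma_{as}$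 in $G(F)$ with $\gamma_{as}$ absolutely semi-simple and $\gamma_{tu}$ topologically unipotent, called its topological Jordan decomposition. *)

(* Defs.v *)
From HB Require Import structures.
From mathcomp Require Import all_boot all_order all_algebra all_field.
From mathcomp Require mpoly.
From mathcomp Require Import all_classical.
From mathcomp Require Import topology.

Set Implicit Arguments.
Unset Strict Implicit.
Unset Printing Implicit Defensive.

Import Order.TTheory GRing.Theory Num.Theory.
Local Open Scope classical_set_scope.
Local Open Scope ring_scope.

(* Discrete valuations are total functions to [int]; the value at 0 is junk.
   [val_ge w N x] is the condition w(x) >= N with the convention w(0) = +oo. *)
Definition is_valuation (K : fieldType) (w : K -> int) : Prop :=
  (forall x y, x != 0 -> y != 0 -> w (x * y) = w x + w y) /\
  (forall x y, x != 0 -> y != 0 -> x + y != 0 ->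
     Num.min (w x) (w y) <= w (x + y)).

Definition val_ge (K : fieldType) (w : K -> int) (N : int) (x : K) : bool :=
  (x == 0) || (N <= w x).

(* A non-archimedean local field: a field, complete for the uniform structure
   of a normalized discrete valuation, with finite residue field.  The residue
   field is given with the reduction map from the valuation ring
   { x | v(x) >= 0 }, of kernel { x | v(x) >= 1 }; the values of [residue]
   outside the valuation ring are junk. *)
HB.mixin Record isNonArchLocal F of GRing.Field F & Uniform F := {
  valuation : F -> int;
  valuationP : is_valuation valuation;
  valuation_normalized : exists2 pi : F, pi != 0 & valuation pi = 1;
  entourage_valuation : forall A : set (F * F),
    entourage A <->
    exists N : int, forall x y : F, val_ge valuation N (x - y) -> A (x, y);
  residue_field : finFieldType;
  residue : F -> residue_field;
  residue1 : residue 1 = 1;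
  residueD : forall x y : F, val_ge valuation 0 x -> val_ge valuation 0 y ->
    residue (x + y) = residue x + residue y;
  residueM : forall x y : F, val_ge valuation 0 x -> val_ge valuation 0 y ->
    residue (x * y) = residue x * residue y;
  residue_surj : forall a : residue_field,
    exists2 x : F, val_ge valuation 0 x & residue x = a;
  residue_eq0 : forall x : F, val_ge valuation 0 x ->
    (residue x = 0 <-> val_ge valuation 1 x)
}.

#[short(type="localFieldType")]
HB.structure Definition NonArchLocalField :=
  {F of GRing.Field F & Complete F & isNonArchLocal F}.

Arguments residue_field : clear implicits.

(* The residue extension is automatically separable, the residue field of [F]
   being finite; so E/F is unramified iff its ramification index is 1, i.e. iff
   the normalized valuation of [F] extends to [E] without enlarging its value
   group. *)
Definition unramified_ext (F : localFieldType) (E : fieldExtType F) : Prop :=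
  exists w : E -> int, is_valuation w /\
    forall a : F, a != 0 -> w (a%:A) = valuation a.

Section MatrixGroups.
Variables (K : fieldType) (n : nat).
Implicit Types S N : set 'M[K]_n.

Definition subgrp S : Prop :=
  [/\ S 1%:M, (forall g, S g -> g \in unitmx),
      (forall g h, S g -> S h -> S (g *m h)) & (forall g, S g -> S (invmx g))].

Definition conjset (g : 'M[K]_n) S : set 'M[K]_n :=
  [set g *m h *m invmx g | h in S].

Definition normal_in S N : Prop :=
  [/\ subgrp N, N `<=` S & forall g, S g -> conjset g N `<=` N].

Definition has_index S N (d : nat) : Prop :=
  card_eq [set [set g *m h | h in N] | g in S] `I_d.

Definition derived S : set 'M[K]_n :=
  smallest subgrp
    [set x | exists g h, [/\ S g, S h & x = g *m h *m invmx g *m invmx h]].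

Definition solvable_grp S : Prop := exists k, iter k derived S = [set 1%:M].

Definition unipotent_mx (g : 'M[K]_n) : Prop := exists k, (g - 1%:M) ^+ k = 0.

End MatrixGroups.

(* Linear algebraic groups are represented by their points over an
   algebraically closed field [L], as Zariski closed subgroups of GL_n(L).  The
   set [k] is (the underlying set of) a subfield of [L] over which objects and
   maps are defined; [k = setT] is the absolute notion.  All fields here have
   characteristic zero, so there is no difference between being closed over [k]
   and being defined over [k]. *)
Section AlgebraicGroups.
Variable L : closedFieldType.
Implicit Types k : set L.

Definition coefs_in m k (P : mpoly.mpoly m L) : Prop :=
  forall u, k (mpoly.mcoeff u P).

Definition mx_eval n (P : mpoly.mpoly (n * n) L) (g : 'M[L]_n) : L :=
  mpoly.meval (fun i => mxvec g 0 i) P.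

Definition zclosed n k (X : set 'M[L]_n) : Prop :=
  exists2 I : set (mpoly.mpoly (n * n) L), I `<=` coefs_in k &
    X = [set g | g \in unitmx /\ forall P, I P -> mx_eval P g = 0].

Definition zconnected n (X : set 'M[L]_n) : Prop :=
  X !=set0 /\
  forall A B, zclosed setT A -> zclosed setT B ->
    X `<=` A `|` B -> X `&` A `&` B = set0 -> X `<=` A \/ X `<=` B.

Definition alg_group n k (G : set 'M[L]_n) : Prop := subgrp G /\ zclosed k G.

Definition regular_map n m k (X : set 'M[L]_n) (f : 'M[L]_n -> 'M[L]_m) : Prop :=
  exists (P : 'I_m -> 'I_m -> mpoly.mpoly (n * n) L) (e : nat),
    (forall i j, coefs_in k (P i j)) /\
    forall g, X g -> forall i j, f g i j = mx_eval (P i j) g / (\det g) ^+ e.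

Definition alg_hom n m k (G : set 'M[L]_n) (G' : set 'M[L]_m)
    (f : 'M[L]_n -> 'M[L]_m) : Prop :=
  [/\ regular_map k G f, (forall g, G g -> G' (f g)) &
      forall g h, G g -> G h -> f (g *m h) = f g *m f h].

Definition alg_isom n m k (G : set 'M[L]_n) (G' : set 'M[L]_m) : Prop :=
  exists f f', [/\ alg_hom k G G' f, alg_hom k G' G f',
    (forall g, G g -> f' (f g) = g) & (forall h, G' h -> f (f' h) = h)].

Definition diag_group d : set 'M[L]_d :=
  [set g | g \in unitmx /\ is_diag_mx g].

Definition split_torus n k (T : set 'M[L]_n) : Prop :=
  alg_group k T /\ exists d, alg_isom k T (@diag_group d).

Definition torus n (T : set 'M[L]_n) : Prop := split_torus setT T.

Definition maximal_torus n (G T : set 'M[L]_n) : Prop :=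
  [/\ torus T, T `<=` G &
      forall T', torus T' -> T' `<=` G -> T `<=` T' -> T' = T].

Definition connected_solvable n (B : set 'M[L]_n) : Prop :=
  [/\ alg_group setT B, zconnected B & solvable_grp B].

Definition borel n (G B : set 'M[L]_n) : Prop :=
  [/\ connected_solvable B, B `<=` G &
      forall B', connected_solvable B' -> B' `<=` G -> B `<=` B' -> B' = B].

(* The unipotent radical is trivial; [G] need not be connected. *)
Definition reductive n (G : set 'M[L]_n) : Prop :=
  forall U, alg_group setT U -> zconnected U -> normal_in G U ->
    (forall u, U u -> unipotent_mx u) -> U = [set 1%:M].

Definition quasi_split n k (G : set 'M[L]_n) : Prop :=
  exists2 B, borel G B & zclosed k B.

Definition split_over n k (G : set 'M[L]_n) : Prop :=
  exists2 T, maximal_torus G T & split_torus k T.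

Definition symmetrization n (theta : 'M[L]_n -> 'M[L]_n) (g : 'M[L]_n) :=
  g *m invmx (theta g).

(* The variety G/H, identified with the image of the symmetrization map. *)
Definition sym_variety n (G : set 'M[L]_n) (theta : 'M[L]_n -> 'M[L]_n) :
  set 'M[L]_n := symmetrization theta @` G.

Definition symmetric_pair n k (G H : set 'M[L]_n)
    (theta : 'M[L]_n -> 'M[L]_n) : Prop :=
  [/\ alg_group k G /\ reductive G,
      alg_group k H /\ reductive H,
      alg_hom k G G theta,
      (forall g, G g -> theta (theta g) = g) &
      H = [set g | G g /\ theta g = g]].

Definition connected_symmetric_pair n k (G H : set 'M[L]_n)
    (theta : 'M[L]_n -> 'M[L]_n) : Prop :=
  symmetric_pair k G H theta /\ zconnected (sym_variety G theta).

End AlgebraicGroups.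

Section LocalGroups.
Variables (F : localFieldType) (L : closedFieldType).
Variable (iota : {rmorphism F -> L}).
Variable n : nat.
Implicit Types (G : set 'M[L]_n) (K N S : set 'M[F]_n) (g : 'M[F]_n).

Definition rat_points (X : set 'M[L]_n) : set 'M[F]_n :=
  [set g | X (map_mx iota g)].

Definition unramified_group G : Prop :=
  quasi_split (range iota) G /\
  exists (E : fieldExtType F) (j : {rmorphism E -> L}),
    [/\ unramified_ext E, (forall a : F, j (a%:A) = iota a) &
        split_over (range j) G].

(* Topological notions refer to 'M[F]_n with the topology given by the
   valuation; it induces the usual topology on GL_n(F). *)

Definition compact_subgroup G K : Prop :=
  [/\ subgrp K, K `<=` rat_points G & compact K].

Definition maximal_compact G K : Prop :=
  compact_subgroup G K /\
  forall K', compact_subgroup G K' -> K `<=` K' -> K' = K.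

Definition profinite_grp S : Prop :=
  [/\ subgrp S, compact S & totally_disconnected S].

Definition pro_p (p : nat) S : Prop :=
  profinite_grp S /\
  forall N, normal_in S N -> (exists2 U, open U & N = S `&` U) ->
    exists e, has_index S N (p ^ e).

Definition is_c (p : nat) K (c : nat) : Prop :=
  profinite_grp K /\
  exists (N : set 'M[F]_n) (d : nat),
    [/\ normal_in K N, pro_p p N, has_index K N d & c = (d`_p^')%N].

(* [c] is the number c_G *)
Definition is_cG (p : nat) G (c : nat) : Prop :=
  exists (d : nat) (K : 'I_d -> set 'M[F]_n) (cK : 'I_d -> nat),
    [/\ (forall i, maximal_compact G (K i)),
        (forall K', maximal_compact G K' ->
           exists i, exists2 g, rat_points G g & K' = conjset g (K i)),
        (forall i j, (exists2 g, rat_points G g & K j = conjset g (K i)) ->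
           i = j),
        (forall i, is_c p (K i) (cK i)) &
        c = \big[lcmn/1%N]_(i < d) cK i].

Definition semisimple g : Prop := diagonalizable (map_mx iota g).

Definition topologically_unipotent G g : Prop :=
  rat_points G g /\
  (fun m : nat => g ^+ (#|residue_field F| ^ m)) @ \oo --> (1%:M : 'M[F]_n).

(* [c] stands for c_G *)
Definition absolutely_semisimple G (c : nat) g : Prop :=
  [/\ rat_points G g, semisimple g & g ^+ c = 1%:M].

Definition strongly_compact G g : Prop :=
  exists2 K, compact_subgroup G K & K g.

Definition topological_Jordan G (c : nat) (x x_as x_tu : 'M[F]_n) : Prop :=
  [/\ x = x_as *m x_tu, x = x_tu *m x_as,
      absolutely_semisimple G c x_as & topologically_unipotent G x_tu].

End LocalGroups.

(* Main.v *)
Require Import Defs.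
From HB Require Import structures.
From mathcomp Require Import all_boot all_order all_algebra all_field.
From mathcomp Require mpoly.
From mathcomp Require Import all_classical.
From mathcomp Require Import topology.
From mathcomp Require Import zify.

Set Implicit Arguments.
Unset Strict Implicit.
Unset Printing Implicit Defensive.

Import Order.TTheory GRing.Theory Num.Theory.
Local Open Scope classical_set_scope.
Local Open Scope ring_scope.

(* Put sigma(g) = theta(g)^-1.  Every x in Q satisfies sigma(x) = x, and Q is
   stable under x |-> y x y when y in G satisfies sigma(y) = y; in particular
   y^2 is then in Q.  If sigma(x) = x, then x_as, being the limit of the powers
   x^(q^(phi(c_G) m)), is also fixed by sigma, and hence so is x_tu.  Since q is
   odd, x_tu has the square root y = lim x_tu^((q^m + 1) / 2), which is fixed by
   sigma and commutes with x_as.  Thus x_tu = y^2, x = y x_as y and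
   x_as = y^-1 x y^-1. *)

(** * Ultrametric inequalities for a discrete valuation *)

Section ValGe.
Variables (K : fieldType) (w : K -> int).
Hypothesis wP : is_valuation w.
Implicit Types (N M : int) (x y : K).

Lemma val_ge0 N : val_ge w N 0.
Proof. by rewrite /val_ge eqxx. Qed.

Lemma val_ge_le N M x : N <= M -> val_ge w M x -> val_ge w N x.
Proof.
by move=> NM /orP[x0|Mx]; apply/orP; [left|right; exact: le_trans Mx].
Qed.

Lemma val_geD N x y : val_ge w N x -> val_ge w N y -> val_ge w N (x + y).
Proof.
rewrite /val_ge; have [->|x0] := eqVneq x 0; first by rewrite add0r.
have [->|y0] := eqVneq y 0; first by rewrite addr0 (negPf x0).
have [//|xy0 /= Nx Ny] := eqVneq (x + y) 0.
by apply: le_trans (wP.2 x y x0 y0 xy0); rewrite le_min Nx.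
Qed.

Lemma val_geM N M x y :
  val_ge w N x -> val_ge w M y -> val_ge w (N + M) (x * y).
Proof.
rewrite /val_ge mulf_eq0.
have [//|x0] := eqVneq x 0; have [//|y0 /= Nx My] := eqVneq y 0.
by rewrite wP.1 // lerD.
Qed.

Lemma val_of_1 : w 1 = 0.
Proof.
have := wP.1 1 1 (oner_neq0 _) (oner_neq0 _).
by rewrite mulr1 -[LHS]addr0 => /addrI.
Qed.

(** From [(-1) * (-1) = 1] one gets [2 w(-1) = 0], hence [w(-1) = 0] in the integers. *)
Lemma val_geN N x : val_ge w N x -> val_ge w N (- x).
Proof.
have n1 : (-1 : K) != 0 by rewrite oppr_eq0 oner_neq0.
have w2 : w (-1) = 0.
  by have := wP.1 _ _ n1 n1; rewrite mulrNN mulr1 val_of_1; lia.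
rewrite -mulN1r -[N in val_ge w N (_ * _)]add0r => Nx; apply: val_geM => //.
by rewrite /val_ge w2 lexx orbT.
Qed.

Lemma val_geB N x y : val_ge w N x -> val_ge w N y -> val_ge w N (x - y).
Proof. by move=> Nx /val_geN; exact: val_geD. Qed.

Lemma val_ge_sum N I (r : seq I) (P : pred I) (f : I -> K) :
  (forall i, P i -> val_ge w N (f i)) -> val_ge w N (\sum_(i <- r | P i) f i).
Proof.
move=> Nf; apply: (big_ind (val_ge w N)) => // [|x y]; first exact: val_ge0.
exact: val_geD.
Qed.

Lemma val_ge_exists x : exists N, val_ge w N x.
Proof. by exists (w x); rewrite /val_ge lexx orbT. Qed.

Lemma val_ge_eq0 x : (forall N, val_ge w N x) -> x = 0.
Proof.
by move=> /(_ (w x + 1)); rewrite /val_ge => /orP[/eqP//|]; lia.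
Qed.

End ValGe.

(** * Limits of sequences in a local field *)

Section LocalFieldLimits.
Variable F : localFieldType.
Implicit Types (u v : nat -> F) (a b : F).
Local Notation vge := (val_ge (@valuation F)).
Let vP := @valuationP F.

Lemma cvg_valP u a :
  u @ \oo --> a <-> forall N, \forall m \near \oo, vge N (u m - a).
Proof.
split=> [/cvg_app_entourageP ua N|ua].
  have /ua : entourage [set z : F * F | vge N (z.1 - z.2)].
    by apply/entourage_valuation; exists N.
  apply: filterS => m /= h; rewrite -opprB; exact: val_geN.
apply/cvg_app_entourageP => A /entourage_valuation[N NA].
by apply: filterS (ua N) => m h; apply: NA; rewrite -opprB; exact: val_geN.
Qed.

(** By the ultrametric inequality, closeness to the single term [u M] makes all later terms close to
    each other; completeness does the rest. *)
Lemma cauchy_val_cvg u :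
  (forall N, exists M, forall m, (M <= m)%N -> vge N (u m - u M)) ->
  exists a, u @ \oo --> a.
Proof.
move=> uC; apply/cvg_ex; apply: cauchy_cvg => A /entourage_valuation[N NA].
have [M uM] := uC N.
exists (u @` [set m | (M <= m)%N], u @` [set m | (M <= m)%N]) => /=.
  by split; exists M => // m /= Mm; exists m.
move=> [_ _] /= [[m Mm <-] [k Mk <-]]; apply: NA.
have -> : u m - u k = (u m - u M) - (u k - u M) by rewrite opprB addrA subrK.
by apply: (val_geB vP); exact: uM.
Qed.

Lemma cvg_val_unique u a b : u @ \oo --> a -> u @ \oo --> b -> a = b.
Proof.
move=> /cvg_valP ua /cvg_valP ub;
apply/subr0_eq/(@val_ge_eq0 _ (@valuation F)) => N.
have [m [h1 h2]] := filter_ex (filterI (ua N) (ub N)).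
by have := val_geB vP h2 h1; rewrite opprB addrC addrA subrK.
Qed.

Lemma cvg_valD u v a b : u @ \oo --> a -> v @ \oo --> b ->
  (fun m => u m + v m) @ \oo --> a + b.
Proof.
move=> /cvg_valP ua /cvg_valP vb; apply/cvg_valP => N.
apply: filterS2 (ua N) (vb N) => m h1 h2.
by rewrite opprD addrACA; exact: val_geD.
Qed.

Lemma cvg_valM u v a b : u @ \oo --> a -> v @ \oo --> b ->
  (fun m => u m * v m) @ \oo --> a * b.
Proof.
move=> /cvg_valP ua /cvg_valP vb; apply/cvg_valP => N.
have [A hA] := val_ge_exists (@valuation F) a.
have [B hB] := val_ge_exists (@valuation F) b.
(* The third condition gives [v m] the same lower bound [B] as its limit; the precision [N - B]
   compensates for it. *)
apply: filterS3 (ua (N - B)) (vb (N - A)) (vb B) => m h1 h2 h3.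
have -> : u m * v m - a * b = (u m - a) * (v m - b + b) + a * (v m - b).
  by rewrite subrK mulrBl mulrBr addrA subrK.
apply: val_geD => //.
  by rewrite -[N](subrK B); apply: val_geM => //; apply: val_geD.
by rewrite -[N](subrK A) addrC; apply: val_geM.
Qed.

End LocalFieldLimits.

(** * Passage of polynomial conditions over [F] to limits of [F]-points *)

Section RationalLimits.
Variables (F : localFieldType) (L : closedFieldType).
Variable (iota : {rmorphism F -> L}).
Implicit Types (s t : nat -> L) (c : L).

(* Convergence, in the topology of [F], of sequences of elements of [L] that
   lie in the image of [F]. *)
Definition rat_cvg s c : Prop :=
  exists (u : nat -> F) (a : F),
    [/\ forall m, s m = iota (u m), c = iota a & u @ \oo --> a].

Lemma rat_cvg_cst c : range iota c -> rat_cvg (fun=> c) c.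
Proof. by case=> a _ <-; exists (fun=> a), a; split=> //; exact: cvg_cst. Qed.

(** Injectivity of [iota] forces both witnesses to use the same sequence in [F]. *)
Lemma rat_cvg_unique s c d : rat_cvg s c -> rat_cvg s d -> c = d.
Proof.
move=> [u [a [su -> ua]]] [v [b [sv -> vb]]]; congr (iota _).
have uv : u = v by apply/funext => m; apply: (fmorph_inj iota); rewrite -su.
by apply: cvg_val_unique ua _; rewrite uv.
Qed.

Lemma rat_cvgD s t c d :
  rat_cvg s c -> rat_cvg t d -> rat_cvg (fun m => s m + t m) (c + d).
Proof.
move=> [u [a [su -> ua]]] [v [b [sv -> vb]]].
exists (fun m => u m + v m), (a + b); split=> [m||]; last exact: cvg_valD.
  by rewrite su sv rmorphD.
by rewrite rmorphD.
Qed.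

Lemma rat_cvgM s t c d :
  rat_cvg s c -> rat_cvg t d -> rat_cvg (fun m => s m * t m) (c * d).
Proof.
move=> [u [a [su -> ua]]] [v [b [sv -> vb]]].
exists (fun m => u m * v m), (a * b); split=> [m||]; last exact: cvg_valM.
  by rewrite su sv rmorphM.
by rewrite rmorphM.
Qed.

Lemma rat_cvg_sum I (r : seq I) (f : I -> nat -> L) (g : I -> L) :
  (forall i, rat_cvg (f i) (g i)) ->
  rat_cvg (fun m => \sum_(i <- r) f i m) (\sum_(i <- r) g i).
Proof.
move=> fg; elim: r => [|i r IHr].
  under eq_fun do rewrite big_nil.
  by rewrite big_nil; apply: rat_cvg_cst; exists 0; rewrite ?rmorph0.
under eq_fun do rewrite big_cons.
by rewrite big_cons; exact: rat_cvgD.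
Qed.

Lemma rat_cvg_prod I (r : seq I) (f : I -> nat -> L) (g : I -> L) :
  (forall i, rat_cvg (f i) (g i)) ->
  rat_cvg (fun m => \prod_(i <- r) f i m) (\prod_(i <- r) g i).
Proof.
move=> fg; elim: r => [|i r IHr].
  under eq_fun do rewrite big_nil.
  by rewrite big_nil; apply: rat_cvg_cst; exists 1; rewrite ?rmorph1.
under eq_fun do rewrite big_cons.
by rewrite big_cons; exact: rat_cvgM.
Qed.

Lemma rat_cvgX s c k : rat_cvg s c -> rat_cvg (fun m => s m ^+ k) (c ^+ k).
Proof.
move=> sc; elim: k => [|k IHk].
  by apply: rat_cvg_cst; exists 1; rewrite ?rmorph1.
by under eq_fun do rewrite exprS; rewrite exprS; exact: rat_cvgM.
Qed.

Variable n : nat.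
Implicit Types (A : nat -> 'M[F]_n) (B : 'M[F]_n).

Definition mx_cvg A B : Prop := forall i j, (fun m => A m i j) @ \oo --> B i j.

Lemma rat_cvg_mx A B i j : mx_cvg A B ->
  rat_cvg (fun m => map_mx iota (A m) i j) (map_mx iota B i j).
Proof.
by exists (fun m => A m i j), (B i j); split=> [m||]; rewrite ?mxE.
Qed.

Lemma rat_cvg_mx_eval A B (P : mpoly.mpoly (n * n) L) :
  mx_cvg A B -> coefs_in (range iota) P ->
  rat_cvg (fun m => mx_eval P (map_mx iota (A m))) (mx_eval P (map_mx iota B)).
Proof.
move=> AB Pk; rewrite /mx_eval mpoly.mevalE.
under eq_fun do rewrite mpoly.mevalE.
apply: rat_cvg_sum => u; apply: rat_cvgM; first exact: rat_cvg_cst.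
apply: rat_cvg_prod => i; apply: rat_cvgX.
case/mxvec_indexP: i => i j; rewrite mxvecE.
by under eq_fun do rewrite mxvecE; exact: rat_cvg_mx.
Qed.

Lemma rat_cvg_det A B : mx_cvg A B ->
  rat_cvg (fun m => \det (map_mx iota (A m))) (\det (map_mx iota B)).
Proof.
move=> AB; apply: rat_cvg_sum => s; apply: rat_cvgM.
  by apply: rat_cvg_cst; exists ((-1) ^+ perm.odd_perm s); rewrite ?rmorph_sign.
by apply: rat_cvg_prod => i; exact: rat_cvg_mx.
Qed.

(** Each defining polynomial is constantly 0 along the sequence, hence 0 at the limit. Invertibility
    of [B] is a separate condition, as a limit of invertible matrices can be singular. *)
Lemma zclosed_mx_cvg (X : set 'M[L]_n) A B : zclosed (range iota) X ->
  mx_cvg A B -> (forall m, rat_points iota X (A m)) -> B \in unitmx ->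
  rat_points iota X B.
Proof.
move=> [I Ik XE] AB XA uB; rewrite /rat_points XE /= map_unitmx.
split=> // P IP.
apply: (rat_cvg_unique (rat_cvg_mx_eval AB (Ik _ IP))).
have -> : (fun m => mx_eval P (map_mx iota (A m))) = fun=> 0.
  by apply/funext => m; have := XA m; rewrite /rat_points XE => -[_ ->].
by apply: rat_cvg_cst; exists 0; rewrite ?rmorph0.
Qed.

(* Multiplying by the denominator of [f] turns f(A) A = 1 into polynomial
   equations, so no continuity of inversion is needed. *)
Lemma regular_map_inv_mx_cvg (X : set 'M[L]_n) (f : 'M[L]_n -> 'M[L]_n) A B :
  regular_map (range iota) X f -> mx_cvg A B ->
  (forall m, rat_points iota X (A m)) -> rat_points iota X B ->
  B \in unitmx -> (forall m, A m \in unitmx) ->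
  (forall m, f (map_mx iota (A m)) *m map_mx iota (A m) = 1%:M) ->
  f (map_mx iota B) *m map_mx iota B = 1%:M.
Proof.
move=> [P [e [Pk fE]]] AB XA XB uB uA fA.
have detB (C : 'M[F]_n) : C \in unitmx -> \det (map_mx iota C) ^+ e != 0.
  by move=> uC; rewrite expf_neq0 // det_map_mx fmorph_eq0 -unitfE.
have numE C i j : rat_points iota X C -> C \in unitmx ->
    (f (map_mx iota C) *m map_mx iota C) i j * \det (map_mx iota C) ^+ e =
    \sum_k mx_eval (P i k) (map_mx iota C) * map_mx iota C k j.
  move=> XC uC; rewrite mxE mulr_suml; apply: eq_bigr => k _.
  by rewrite fE // mulrAC divfK ?detB.
apply/matrixP => i j; apply: (mulIf (detB B uB)); rewrite numE //.
have sumB : rat_cvg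
    (fun m =>
       \sum_k mx_eval (P i k) (map_mx iota (A m)) * map_mx iota (A m) k j)
    (\sum_k mx_eval (P i k) (map_mx iota B) * map_mx iota B k j).
  apply: rat_cvg_sum => k; apply: rat_cvgM; last exact: rat_cvg_mx.
  exact: rat_cvg_mx_eval.
apply: rat_cvg_unique sumB _.
(* Along the sequence the same sums are entries of the identity times a power of the determinant,
   which gives a second expression for the limit. *)
under eq_fun => m do rewrite -numE // fA.
apply: rat_cvgM; last by apply/rat_cvgX/rat_cvg_det.
apply: rat_cvg_cst; exists ((1%:M : 'M[F]_n) i j) => //.
by rewrite !mxE rmorph_nat.
Qed.

End RationalLimits.

(** * Entrywise limits and valuation bounds for matrices *)

Section MatrixLimits.
Variables (F : localFieldType) (n : nat).
Implicit Types (A B C D U : nat -> 'M[F]_n) (a b u : 'M[F]_n) (N : int).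
Let vP := @valuationP F.

Lemma cvg_mx_cvg A b : A @ \oo --> b -> mx_cvg A b.
Proof.
move=> Ab i j W bW; apply: (Ab [set M | W (M i j)]).
(* This family of neighbourhoods constrains only the entry [(i, j)]; at every other position it is
   the whole field. *)
exists (fun i' j' => [set c | i' = i -> j' = j -> W c]) => [i' j'|M hM] /=;
  last exact: hM.
have [->|ni] := eqVneq i' i; last by apply: nearW => c /eqP; rewrite (negPf ni).
have [->|nj] := eqVneq j' j; first by apply: filterS bW => c Wc _ _.
by apply: nearW => c _ /eqP; rewrite (negPf nj).
Qed.

Lemma mx_cvg_unique A a b : mx_cvg A a -> mx_cvg A b -> a = b.
Proof.
by move=> Aa Ab; apply/matrixP => i j; exact: cvg_val_unique (Aa i j) (Ab i j).
Qed.

Lemma mx_cvg_cst a : mx_cvg (fun=> a) a.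
Proof. by move=> i j; exact: cvg_cst. Qed.

Lemma mx_cvgM A B a b :
  mx_cvg A a -> mx_cvg B b -> mx_cvg (fun m => A m *m B m) (a *m b).
Proof.
move=> Aa Bb i j; rewrite mxE; under [X in X @ _]eq_fun do rewrite mxE.
elim: (index_enum _) => [|k r IHr].
  rewrite big_nil; under [X in X @ _]eq_fun do rewrite big_nil; exact: cvg_cst.
rewrite big_cons; under [X in X @ _]eq_fun do rewrite big_cons.
exact: cvg_valD (cvg_valM (Aa i k) (Bb k j)) IHr.
Qed.

Definition mx_ge N a : Prop := forall i j, val_ge (@valuation F) N (a i j).

Lemma mx_cvg_near A a N :
  mx_cvg A a -> \forall m \near \oo, mx_ge N (A m - a).
Proof.
move=> Aa; apply: filter_forall => i; apply: filter_forall => j.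
by have /cvg_valP/(_ N) := Aa i j; apply: filterS => m; rewrite !mxE.
Qed.

Lemma mx_ge_exists a : exists N, mx_ge N a.
Proof.
have /choice[v hv] (ij : 'I_n * 'I_n) :
    exists N, val_ge (@valuation F) N (a ij.1 ij.2) by exact: val_ge_exists.
exists (\big[Order.min/0]_ij v ij) => i j.
by apply: (@val_ge_le _ _ _ (v (i, j))) (hv (i, j)); exact: bigmin_le.
Qed.

Lemma mx_ge_le N M a : N <= M -> mx_ge M a -> mx_ge N a.
Proof. by move=> NM Ma i j; exact: val_ge_le (Ma i j). Qed.

Lemma mx_geD N a b : mx_ge N a -> mx_ge N b -> mx_ge N (a + b).
Proof. by move=> Na Nb i j; rewrite mxE; exact: val_geD. Qed.

Lemma mx_geM N M a b : mx_ge N a -> mx_ge M b -> mx_ge (N + M) (a *m b).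
Proof.
by move=> Na Mb i j; rewrite mxE; apply: val_ge_sum => // k _; exact: val_geM.
Qed.

Lemma mx_ge1 : mx_ge 0 1%:M.
Proof.
move=> i j; rewrite mxE; case: eqP => _; last exact: val_ge0.
by rewrite /val_ge val_of_1 ?lexx ?orbT.
Qed.

(** Induction on [t], writing [a^(t+1) - 1] as [(a - 1)(a^t - 1) + (a - 1) + (a^t - 1)]; the product
    has bound [2N], and [2N >= N] because [N >= 0]. *)
Lemma mx_ge_exprB1 N a t : 0 <= N -> mx_ge N (a - 1) -> mx_ge N (a ^+ t - 1).
Proof.
move=> N0 Na; elim: t => [|t IHt].
  by rewrite expr0 subrr => i j; rewrite mxE; exact: val_ge0.
have -> : a ^+ t.+1 - 1 = (a - 1) * (a ^+ t - 1) + ((a - 1) + (a ^+ t - 1)).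
  rewrite [a - 1 + _]addrC addrA [(a - 1) * _]mulrBl mul1r subrK.
  by rewrite mulrBr mulr1 addrA subrK exprS.
apply: mx_geD; last exact: mx_geD.
by apply: (@mx_ge_le _ (N + N)); [lia | exact: mx_geM].
Qed.

(** * Square roots of topologically unipotent matrices *)

Section SquareRoot.
Variables (u : 'M[F]_n) (q : nat).
Hypotheses (q_odd : odd q) (u1 : mx_cvg (fun m => u ^+ (q ^ m)) 1%:M).

(** As [q] is odd, [(q^m + 1)/2 = (q^M + 1)/2 + q^M (q^(m-M) - 1)/2]. *)
Let uphalf_expn M m : (M <= m)%N ->
  exists t, uphalf (q ^ m) = (uphalf (q ^ M) + q ^ M * t)%N.
Proof.
move=> Mm; exists (q ^ (m - M))./2.
rewrite -{1}(subnKC Mm) expnD -{1}(odd_double_half (q ^ (m - M))).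
rewrite oddX q_odd orbT mulnDr muln1 -doubleMr; set z := (_ * _)%N.
lia.
Qed.

(** The sequence is Cauchy: a later term is an earlier one times a power of [u ^+ (q ^ M)], which is
    close to 1. *)
Lemma mx_cvg_uphalf : exists y, mx_cvg (fun m => u ^+ uphalf (q ^ m)) y.
Proof.
have u_near N : exists M, forall m, (M <= m)%N -> mx_ge N (u ^+ (q ^ m) - 1%:M).
  by have [M _ hM] := mx_cvg_near N u1; exists M.
have [M0 hM0] := u_near 0.
(* A bound for the term at [M0] holds for all later terms, since they differ from it by integral
   factors. *)
have [B hB] := mx_ge_exists (u ^+ uphalf (q ^ M0)).
have uB m : (M0 <= m)%N -> mx_ge B (u ^+ uphalf (q ^ m)).
  move=> /uphalf_expn[t ->]; rewrite exprD exprM -[B]addr0; apply: mx_geM => //.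
  rewrite -[X in mx_ge _ X](subrK 1); apply: mx_geD mx_ge1.
  exact/mx_ge_exprB1/hM0.
have /choice[y hy] (ij : 'I_n * 'I_n) :
    exists a : F, (fun m => (u ^+ uphalf (q ^ m)) ij.1 ij.2) @ \oo --> a.
  case: ij => i j /=; apply: cauchy_val_cvg => N.
  (* [N - B] offsets the bound [B] of the other factor; the maximum with 0 meets the sign condition
     of [mx_ge_exprB1]. *)
  have [M1 hM1] := u_near (Num.max 0 (N - B)).
  exists (maxn M0 M1) => m Mm; have [t ->] := uphalf_expn Mm.
  move: (maxn M0 M1) (leq_maxl M0 M1) (leq_maxr M0 M1) => M M0M M1M.
  suff /(_ i j) : mx_ge N
      (u ^+ (uphalf (q ^ M) + q ^ M * t) - u ^+ uphalf (q ^ M)).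
    by rewrite !mxE.
  rewrite exprD exprM -[X in _ - X]mulr1 -mulrBr.
  apply: (@mx_ge_le _ (B + Num.max 0 (N - B))); first by lia.
  apply: mx_geM; first exact: uB.
  by apply: mx_ge_exprB1; [lia | exact: hM1].
exists (\matrix_(i, j) y (i, j)) => i j; rewrite mxE; exact: (hy (i, j)).
Qed.

(** Twice [uphalf (q ^ m)] is [q ^ m + 1], so the squares are [u ^+ (q ^ m) *m u], which tend to
    [u]. *)
Lemma uphalf_limit_sqr y :
  mx_cvg (fun m => u ^+ uphalf (q ^ m)) y -> y *m y = u.
Proof.
move=> uy; apply: mx_cvg_unique (mx_cvgM uy uy) _.
rewrite -[u in mx_cvg _ u]mul1mx.
have -> : (fun m => u ^+ uphalf (q ^ m) *m u ^+ uphalf (q ^ m)) =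
    fun m => u ^+ (q ^ m) *m u.
  apply/funext => m; rewrite -!/(_ * _) -exprD -exprSr; congr (_ ^+ _).
  by have := oddX q m; rewrite q_odd orbT; lia.
by apply: mx_cvgM => //; exact: mx_cvg_cst.
Qed.

End SquareRoot.

End MatrixLimits.

(** * Algebra of the elements fixed by sigma, and of G/H inside them *)

Section SplitElements.
Variables (L : closedFieldType) (n : nat) (G : set 'M[L]_n).
Variable theta : 'M[L]_n -> 'M[L]_n.
Hypothesis Ggrp : subgrp G.
Hypothesis thetaG : forall g, G g -> G (theta g).
Hypothesis thetaM :
  forall g h, G g -> G h -> theta (g *m h) = theta g *m theta h.
Hypothesis thetaK : forall g, G g -> theta (theta g) = g.
Implicit Types g h x y : 'M[L]_n.

(* For g in G this says theta(g)^-1 = g, i.e. sigma(g) = g. *)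
Definition theta_split g : Prop := theta g *m g = 1%:M.

Let G1 : G 1%:M. Proof. by case: Ggrp. Qed.
Let Gu g : G g -> g \in unitmx. Proof. by case: Ggrp => _ + _ _; apply. Qed.
Let GM g h : G g -> G h -> G (g *m h).
Proof. by case: Ggrp => _ _ + _; apply. Qed.
Let GV g : G g -> G (invmx g). Proof. by case: Ggrp => _ _ _; apply. Qed.

Lemma theta1 : theta 1%:M = 1%:M.
Proof.
have u1 := Gu (thetaG G1).
by rewrite -[LHS](mulmxK u1) -thetaM // mulmx1 mulmxV.
Qed.

Lemma thetaV g : G g -> theta (invmx g) = invmx (theta g).
Proof.
move=> Gg; have ug := Gu (thetaG Gg).
rewrite -[LHS](mulmxK ug) -thetaM ?mulVmx ?theta1 ?mul1mx //; first exact: Gu.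
exact: GV.
Qed.

Lemma subgrp_expr g k : G g -> G (g ^+ k).
Proof. by move=> Gg; elim: k => // k; rewrite exprS; exact: GM. Qed.

(** The product telescopes: [theta (g ^+ k) *m g ^+ k] sits between [theta g] and [g]. *)
Lemma theta_split_expr g k : G g -> theta_split g -> theta_split (g ^+ k).
Proof.
rewrite /theta_split => Gg sg; elim: k => [|k IHk].
  by rewrite theta1 mulmx1.
rewrite {1}exprS exprSr thetaM //; last exact: subgrp_expr.
by rewrite -mulmxA (mulmxA (theta (g ^+ k))) IHk mul1mx.
Qed.

Lemma theta_split_inv g : G g -> theta_split g -> theta_split (invmx g).
Proof.
rewrite /theta_split => Gg /mulmx1C sg; rewrite thetaV //.
have -> : invmx g = theta g by rewrite -[LHS]mulmx1 -sg mulKmx // Gu.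
by rewrite mulVmx //; exact/Gu/thetaG.
Qed.

(** Inserting [g *m theta g = 1] on both sides of [theta h *m h] makes [theta (g *m h) *m (h *m g)]
    appear in the middle. *)
Lemma theta_split_cancel g h : G g -> G h -> g *m h = h *m g ->
  theta_split g -> theta_split (g *m h) -> theta_split h.
Proof.
rewrite /theta_split => Gg Gh gh /mulmx1C sg; rewrite thetaM // gh => sgh.
rewrite -[LHS]mul1mx -sg -[LHS]mulmx1 -[in X in _ *m X]sg.
rewrite !mulmxA -(mulmxA g) -(mulmxA g) -(mulmxA g) -(mulmxA _ h).
by rewrite sgh mulmx1 sg.
Qed.

Lemma sym_variety1 : sym_variety G theta 1%:M.
Proof. by exists 1%:M; rewrite // /symmetrization theta1 mul1mx invmx1. Qed.

(** As [theta] is an involution, it sends [g theta(g)^-1] to its inverse. The converse fails in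
    general: for trivial [theta] every [g] with [g^2 = 1] is split. *)
Lemma sym_variety_theta_split x : sym_variety G theta x -> G x /\ theta_split x.
Proof.
move=> [g Gg <-]; rewrite /theta_split /symmetrization.
have [Gtg ug utg] := And3 (thetaG Gg) (Gu Gg) (Gu (thetaG Gg)).
split; first by apply: GM => //; exact: GV.
rewrite thetaM ?thetaV ?thetaK //; last exact: GV.
by rewrite mulmxA mulmxKV // mulmxV.
Qed.

(** If [g] symmetrizes to [x], then [y *m g] symmetrizes to [y *m x *m y], because
    [theta(y)^-1 = y]. *)
Lemma sym_variety_twist x y : G y -> theta_split y ->
  sym_variety G theta x -> sym_variety G theta (y *m x *m y).
Proof.
move=> Gy sy [g Gg <-]; exists (y *m g); first exact: GM.
have [uy ug] := (Gu (thetaG Gy), Gu (thetaG Gg)).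
rewrite /symmetrization thetaM // -!mulmxA; congr (_ *m (_ *m _)).
apply: (can_inj (mulKmx ug)); rewrite mulKVmx //.
apply: (can_inj (mulKmx uy)); rewrite sy mulmxA mulmxV //.
by rewrite unitmx_mul uy.
Qed.

End SplitElements.

(** * The absolutely semi-simple part as a limit of powers *)

Lemma coprime_cG (F : localFieldType) (p : nat)
    (hp : p \in [pchar (residue_field F)]) (L : closedFieldType)
    (iota : {rmorphism F -> L}) (n : nat) (G : set 'M[L]_n) (c : nat) :
  is_cG iota p G c -> (0 < c)%N /\ coprime #|residue_field F| c.
Proof.
move=> [d [K [cK [_ _ _ cKP ->]]]].
have pc : (p^'.-nat (\big[lcmn/1]_(i < d) cK i))%N.
  elim/big_ind: _ => // [a b pa pb|i _].
    (* The least common multiple divides the product, which is prime to [p]. *)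
    apply: pnat_dvd (_ : (p^'.-nat (a * b))%N); last by rewrite pnatM pa.
    by rewrite dvdn_lcm dvdn_mulr ?dvdn_mull.
  by have [_ [N [e [_ _ _ ->]]]] := cKP i; exact: part_pnat.
split; first by case/andP: pc.
by apply: pnat_coprime pc; rewrite -cardsT; exact: finfield.pprimeChar_pgroup.
Qed.

(** By Euler, [q^(phi(c) m)] is 1 modulo [c], so these powers fix [s], while those of [t] form a
    subsequence tending to 1. *)
Lemma absolutely_semisimple_limit (F : localFieldType) (n c : nat)
    (x s t : 'M[F]_n) (q := #|residue_field F|) :
  (0 < c)%N -> coprime q c -> s ^+ c = 1 -> x = s *m t -> s *m t = t *m s ->
  mx_cvg (fun m => t ^+ (q ^ m)) 1%:M ->
  mx_cvg (fun m => x ^+ (q ^ (totient c * m))) s.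
Proof.
move=> c0 qc sc -> st t1; rewrite -[s in mx_cvg _ s]mulmx1.
have -> : (fun m => (s *m t) ^+ (q ^ (totient c * m))) =
    fun m => s *m t ^+ (q ^ (totient c * m)).
  apply/funext => m; rewrite exprMn_comm //; congr (_ *m _).
  rewrite -(expr_mod _ sc) expnM -modnXm cyclic.Euler_exp_totient //.
  by rewrite modnXm exp1n expr_mod.
apply: mx_cvgM; first exact: mx_cvg_cst.
move=> i j; have := t1 i j.
apply: (@cvg_comp _ _ _ (fun m => (totient c * m)%N)).
move=> A [M _ MA]; exists M => // m Mm; apply: MA => /=.
by apply: leq_trans Mm _; rewrite leq_pmull // totient_gt0.
Qed.

(** * Membership in G/H under the topological Jordan decomposition *)

Theorem proposition3p6
    (F : localFieldType) (hF0 : [pchar F] =i pred0)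
    (p : nat) (hp : p \in [pchar (residue_field F)]) (hodd : odd p)
    (L : closedFieldType) (iota : {rmorphism F -> L})
    (hL : forall z : L, algebraicOver iota z)
    (n : nat) (G H : set 'M[L]_n) (theta : 'M[L]_n -> 'M[L]_n)
    (hpair : connected_symmetric_pair (range iota) G H theta)
    (hGconn : zconnected G) (hGunr : unramified_group iota G)
    (cG : nat) (hcG : is_cG iota p G cG)
    (x x_as x_tu : 'M[F]_n)
    (hx : strongly_compact iota G x)
    (hJ : topological_Jordan iota G cG x x_as x_tu) :
  rat_points iota (sym_variety G theta) x <->
  rat_points iota (sym_variety G theta) x_as /\
  rat_points iota (sym_variety G theta) x_tu.
Proof.
have [[[[Ggrp Gzc] _] _ [theta_reg thetaG thetaM] thetaK _] _] := hpair.
have [x_dec x_dec' [Gas _ as_c] [Gtu tu_cvg]] := hJ.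
set q := #|_| in tu_cvg.
have q_odd : odd q.
  have /p_natP[k qE] : p.-nat q.
    by rewrite /q -cardsT; exact: finfield.pprimeChar_pgroup.
  by rewrite qE oddX hodd orbT.
have tu1 : mx_cvg (fun m => x_tu ^+ (q ^ m)) 1%:M by exact: cvg_mx_cvg.
have as_tu : x_as *m x_tu = x_tu *m x_as by rewrite -x_dec.
have Gunit a : rat_points iota G a -> a \in unitmx.
  by have [_ + _ _] := Ggrp => /[apply]; rewrite map_unitmx.
(* Fixedness by sigma is a closed condition; this serves for both [x_as] and the square root of
   [x_tu]. *)
have limit_split (a b : 'M[F]_n) (k : nat -> nat) :
    rat_points iota G a -> theta_split theta (map_mx iota a) ->
    b \in unitmx -> mx_cvg (fun m => a ^+ k m) b ->
    rat_points iota G b /\ theta_split theta (map_mx iota b).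
  move=> Ga sa ub ab.
  have Gak m : rat_points iota G (a ^+ k m).
    by rewrite /rat_points /= rmorphXn; exact: subgrp_expr.
  have Gb := zclosed_mx_cvg Gzc ab Gak ub; split=> //.
  apply: (regular_map_inv_mx_cvg theta_reg ab Gak Gb ub) => m.
    exact/Gunit/Gak.
  by rewrite rmorphXn; exact: (theta_split_expr Ggrp).
have tu_sqrt : theta_split theta (map_mx iota x_tu) -> exists y : 'M[F]_n,
    [/\ rat_points iota G y, theta_split theta (map_mx iota y),
        y *m y = x_tu & x_as *m y = y *m x_as].
  move=> s_tu; have [y tu_y] := mx_cvg_uphalf q_odd tu1.
  have yy := uphalf_limit_sqr q_odd tu1 tu_y; exists y.
  (* The limit [y] is so far only a matrix; it is invertible because its square [x_tu] is. *)
  have uy : y \in unitmx.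
    by have := Gunit _ Gtu; rewrite -yy unitmx_mul => /andP[].
  have [Gy sy] := limit_split _ _ _ Gtu s_tu uy tu_y; split=> //.
  apply: mx_cvg_unique (mx_cvgM (@mx_cvg_cst _ _ x_as) tu_y) _.
  have -> : (fun m => x_as *m x_tu ^+ uphalf (q ^ m)) =
      fun m => x_tu ^+ uphalf (q ^ m) *m x_as.
    by apply/funext => m; apply: commrX.
  by apply: mx_cvgM => //; exact: mx_cvg_cst.
split=> [Qx|[Qas Qtu]].
  have [Gx sx] := sym_variety_theta_split Ggrp thetaG thetaM thetaK Qx.
  have [c0 qc] := coprime_cG hp hcG.
  have [_ s_as] := limit_split _ _ _ Gx sx (Gunit _ Gas)
    (absolutely_semisimple_limit c0 qc as_c x_dec as_tu tu1).
  have s_tu : theta_split theta (map_mx iota x_tu).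
    apply: (theta_split_cancel thetaM) Gas Gtu _ s_as _.
      by rewrite -!map_mxM as_tu.
    by rewrite -map_mxM as_tu -x_dec'.
  have [y [Gy sy yy asy]] := tu_sqrt s_tu; have uy := Gunit _ Gy.
  split; rewrite /rat_points /=.
    (* Since [x = y^2 x_as] and [y] commutes with [x_as], [x_as] is the twist of [x] by [y^-1]. *)
    have -> : x_as = invmx y *m x *m invmx y.
      by rewrite x_dec' -yy !mulmxA mulVmx // mul1mx -asy mulmxK.
    rewrite !map_mxM map_invmx; apply: sym_variety_twist => //.
      by case: Ggrp => _ _ _; apply.
    exact: (theta_split_inv Ggrp).
  (* [x_tu] is the twist by [y] of the identity. *)
  rewrite -yy map_mxM -[X in X *m _]mulmx1.
  by apply: sym_variety_twist => //; exact: sym_variety1.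
have [_ s_tu] := sym_variety_theta_split Ggrp thetaG thetaM thetaK Qtu.
have [y [Gy sy yy asy]] := tu_sqrt s_tu.
(* Here [x = y x_as y] is the twist of [x_as] by [y]. *)
rewrite /rat_points /= x_dec -yy mulmxA asy !map_mxM.
exact: sym_variety_twist.
Qed.
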